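(* Let $G$ be a finite group all of whose subgroups are normal. If two irreducible positive representations of $G$ in finite dimensional Archimedean Riesz spaces are linearly equivalent (equivalently: have the same character), then they are order equivalent.
   Context: All Riesz spaces (vector lattices) are real. A positive representation of $G$ in a Riesz space $E$ is a group homomorphism $\rho\colon G\to\mathrm{Aut}^+(E)$, $s\mapsto\rho_s$, where $\mathrm{Aut}^+(E)$ is the group of lattice automorphisms of $E$. In a finite dimensional Archimedean Riesz space the ideals, (principal) bands and projection bands coincide, and a positive representation in such a space is called irreducible if the only invariant bands are $\{0\}$ and the whole space. Two positive representations $\rho$ in $E$ and $\theta$ in $F$ of $G$ are linearly equivalent if there is an invertible linear map $T\colon E\to F$ with $T\rho_s=\theta_sT$ for all $s\in G$; they are order equivalent if $T$ can be chosen to be a lattice isomorphism. The character of a finite dimensional $\rho$ is the function $s\mapsto\mathrm{tr}(\rho_s)$. *)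

(* Defs.v *)
From HB Require Import structures.
From mathcomp Require Import all_boot all_order all_algebra all_fingroup.
From mathcomp Require Import classical_sets reals.

Set Implicit Arguments.
Unset Strict Implicit.
Unset Printing Implicit Defensive.

Import Order.TTheory GRing.Theory Num.Theory.
Local Open Scope ring_scope.

(* The lattice operations are fields of the mixin rather than inherited from
   [Order.Lattice]: MathComp has no join of the lattice structures with the
   algebraic structures below [Num.RealDomain], so Hierarchy Builder rejects a
   structure inheriting from both [Order.Lattice] and [GRing.Lmodule]. *)
HB.mixin Record POrderedLmodule_isRiesz (R : realType) E
    of Num.POrderedZmodule E & GRing.Lmodule R E := {
  riesz_leD2r : forall z x y : E, x <= y -> x + z <= y + z ;
  riesz_scale_ge0 : forall (a : R) (x : E), 0 <= a -> 0 <= x -> 0 <= a *: x ;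
  riesz_sup : E -> E -> E ;
  riesz_inf : E -> E -> E ;
  riesz_supP : forall x y z : E,
    (riesz_sup x y <= z) = (x <= z) && (y <= z) ;
  riesz_infP : forall x y z : E,
    (z <= riesz_inf x y) = (z <= x) && (z <= y)
}.

#[short(type="rieszType")]
HB.structure Definition Riesz (R : realType) :=
  { E of Num.POrderedZmodule E & GRing.Lmodule R E
       & POrderedLmodule_isRiesz R E }.

#[short(type="finRieszType")]
HB.structure Definition FinRiesz (R : realType) :=
  { E of Riesz R E & Vector R E }.

Definition archimedean_riesz (R : realType) (E : rieszType R) : Prop :=
  forall u v : E, 0 <= u -> (forall n : nat, u *+ n <= v) -> u = 0.

(* Not [`|x|], which is a norm with values in a [numDomainType]. *)
Definition riesz_abs (R : realType) (E : rieszType R) (x : E) : E :=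
  riesz_sup x (- x).

Section FiniteDimensional.
Variable R : realType.

Definition is_ideal (E : finRieszType R) (B : {vspace E}) : Prop :=
  forall x y : E, y \in B -> riesz_abs x <= riesz_abs y -> x \in B.

Definition is_band (E : finRieszType R) (B : {vspace E}) : Prop :=
  is_ideal B /\
  forall (D : set E) (x : E),
    (forall y, D y -> y \in B) -> supremums D x -> x \in B.

Definition lattice_iso (E F : finRieszType R) (T : 'Hom(E, F)) : Prop :=
  [/\ bijective T,
      {morph T : x y / riesz_sup x y >-> riesz_sup x y}
    & {morph T : x y / riesz_inf x y >-> riesz_inf x y}].

Section Representations.
Variables (gT : finGroupType) (G : {group gT}).

(* As for [mx_representation], only the values on [G] are meaningful. *)
Record pos_repr (E : finRieszType R) := PosRepr {
  pos_repr_fun :> gT -> 'End(E) ;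
  pos_repr_aut : forall s, s \in G -> lattice_iso (pos_repr_fun s) ;
  pos_reprM : forall s t, s \in G -> t \in G ->
    pos_repr_fun (s * t)%g = (pos_repr_fun s \o pos_repr_fun t)%VF
}.

Definition invariant (E : finRieszType R) (rho : pos_repr E)
    (B : {vspace E}) : Prop :=
  forall s, s \in G -> (rho s @: B <= B)%VS.

Definition irreducible (E : finRieszType R) (rho : pos_repr E) : Prop :=
  forall B : {vspace E}, is_band B -> invariant rho B ->
    B = 0%VS \/ B = fullv.

Definition intertwines (E F : finRieszType R) (rho : pos_repr E)
    (theta : pos_repr F) (T : 'Hom(E, F)) : Prop :=
  forall s, s \in G -> (T \o rho s)%VF = (theta s \o T)%VF.

Definition linearly_equivalent (E F : finRieszType R) (rho : pos_repr E)
    (theta : pos_repr F) : Prop :=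
  exists T : 'Hom(E, F), bijective T /\ intertwines rho theta T.

Definition order_equivalent (E F : finRieszType R) (rho : pos_repr E)
    (theta : pos_repr F) : Prop :=
  exists T : 'Hom(E, F), lattice_iso T /\ intertwines rho theta T.

Definition lftrace (E : vectType R) (f : 'End(E)) : R :=
  \tr (passmx.mxof (vbasis {:E}) (vbasis {:E}) f).

Definition pos_character (E : finRieszType R) (rho : pos_repr E) (s : gT) : R :=
  lftrace (rho s).

End Representations.
End FiniteDimensional.

(* Main.v *)
Require Import Defs.
From mathcomp Require Import all_boot all_order all_algebra all_fingroup.
From mathcomp Require Import boolp classical_sets reals.

(* In an Archimedean Riesz space a nonzero positive element which is not an atom
   splits into two disjoint nonzero ones; disjoint elements are linearly
   independent, so in finite dimension atoms exist. The images of an atom e under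
   a finite group G of lattice automorphisms are atoms, pairwise equal or disjoint
   (proportional ones are equal since G has finite order). They span an invariant
   band, so for an irreducible representation they form a basis, which G permutes
   transitively. The stabilizer H of e being normal, it fixes every element of
   this basis: the character is dim E on H and 0 on G \ H, hence determines H,
   and rho_s e |-> theta_s f is an order equivalence as soon as the stabilizers of
   the atoms e and f agree. *)

Set Implicit Arguments.
Unset Strict Implicit.
Unset Printing Implicit Defensive.

Import Order.TTheory GRing.Theory Num.Theory.
Local Open Scope ring_scope.

(** * Order and lattice calculus in a Riesz space *)

Section RieszTheory.
Variables (R : realType) (E : rieszType R).
Implicit Types e f t x y z u v w : E.

Lemma rieszD2r z x y : (x + z <= y + z) = (x <= y).
Proof.
apply/idP/idP => [|/riesz_leD2r]; last exact.
by move=> /(riesz_leD2r (- z)); rewrite !addrK.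
Qed.

Lemma rieszD2l z x y : (z + x <= z + y) = (x <= y).
Proof. by rewrite ![z + _]addrC rieszD2r. Qed.

Lemma riesz_subr_ge0 x y : (0 <= y - x) = (x <= y).
Proof. by rewrite -(rieszD2r x 0) add0r subrK. Qed.

Lemma riesz_leBlDr x y z : (x - y <= z) = (x <= z + y).
Proof. by rewrite -(rieszD2r y (x - y)) subrK. Qed.

Lemma riesz_leBrDr x y z : (x <= y - z) = (x + z <= y).
Proof. by rewrite -(rieszD2r z x) subrK. Qed.

Lemma riesz_oppr_ge0 x : (0 <= - x) = (x <= 0).
Proof. by rewrite -sub0r riesz_subr_ge0. Qed.

Lemma riesz_leN2 x y : (- x <= - y) = (y <= x).
Proof.
by rewrite -(rieszD2r (x + y) (- x)) addrA addNr add0r addrCA addNr addr0.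
Qed.

Lemma riesz_leD x y z t : x <= y -> z <= t -> x + z <= y + t.
Proof.
by move=> xy zt; rewrite (@le_trans _ _ (y + z)) ?rieszD2r ?rieszD2l.
Qed.

Lemma riesz_addr_ge0 x y : 0 <= x -> 0 <= y -> 0 <= x + y.
Proof. by move=> x0 y0; rewrite -[0]addr0 riesz_leD. Qed.

Lemma riesz_lewDr x y : 0 <= y -> x <= x + y.
Proof. by move=> y0; rewrite -{1}[x]addr0 rieszD2l. Qed.

Lemma riesz_sum_ge0 I (r : seq I) (P : pred I) (f : I -> E) :
  (forall i, P i -> 0 <= f i) -> 0 <= \sum_(i <- r | P i) f i.
Proof.
by move=> f0; elim/big_rec: _ => // i x Pi; apply: riesz_addr_ge0; apply: f0.
Qed.

Lemma riesz_ler_sum I (r : seq I) (P : pred I) (f g : I -> E) :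
  (forall i, P i -> f i <= g i) ->
  \sum_(i <- r | P i) f i <= \sum_(i <- r | P i) g i.
Proof.
by move=> fg; elim/big_rec2: _ => // i x y Pi; apply: riesz_leD; apply: fg.
Qed.

Lemma riesz_lerZl (a : R) x y : 0 <= a -> x <= y -> a *: x <= a *: y.
Proof.
by move=> a0; rewrite -(riesz_subr_ge0 x) -(riesz_subr_ge0 (a *: x)) -scalerBr;
  exact: riesz_scale_ge0.
Qed.

Lemma riesz_lerZr (a b : R) x : 0 <= x -> a <= b -> a *: x <= b *: x.
Proof.
move=> x0 ab; rewrite -riesz_subr_ge0 -scalerBl.
by rewrite riesz_scale_ge0 ?subr_ge0.
Qed.

Lemma riesz_le_supl x y : x <= riesz_sup x y.
Proof. by have := lexx (riesz_sup x y); rewrite riesz_supP => /andP[]. Qed.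

Lemma riesz_le_supr x y : y <= riesz_sup x y.
Proof. by have := lexx (riesz_sup x y); rewrite riesz_supP => /andP[]. Qed.

Lemma riesz_infl x y : riesz_inf x y <= x.
Proof. by have := lexx (riesz_inf x y); rewrite riesz_infP => /andP[]. Qed.

Lemma riesz_infr x y : riesz_inf x y <= y.
Proof. by have := lexx (riesz_inf x y); rewrite riesz_infP => /andP[]. Qed.

Lemma riesz_infC x y : riesz_inf x y = riesz_inf y x.
Proof. by apply: le_anti; rewrite !riesz_infP !riesz_infl !riesz_infr. Qed.

Lemma riesz_inf_ge0 x y : 0 <= x -> 0 <= y -> 0 <= riesz_inf x y.
Proof. by move=> x0 y0; rewrite riesz_infP x0. Qed.

Lemma riesz_inf_idl x y : x <= y -> riesz_inf x y = x.
Proof. by move=> xy; apply: le_anti; rewrite riesz_infl riesz_infP lexx. Qed.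

(** Moving one infimum at a time to the left-hand side reduces the claim to [w <= x] and
    [w <= y + z]. This is what makes disjointness stable under sums. *)
Lemma riesz_inf_subadd x y z : 0 <= x -> 0 <= y -> 0 <= z ->
  riesz_inf x (y + z) <= riesz_inf x y + riesz_inf x z.
Proof.
move=> x0 y0 z0; set w := riesz_inf x (y + z).
have wx : w <= x by exact: riesz_infl.
rewrite -riesz_leBlDr riesz_infP !riesz_leBlDr; apply/andP; split.
  by rewrite (le_trans wx)// riesz_lewDr// riesz_inf_ge0.
rewrite addrC -riesz_leBlDr riesz_infP !riesz_leBlDr.
by rewrite (le_trans wx) ?riesz_lewDr// addrC riesz_infr.
Qed.

(** * Disjoint positive elements, positive and negative parts, absolute values *)

Definition disjoint_pos x y := [/\ 0 <= x, 0 <= y & riesz_inf x y = 0].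

Lemma disjoint_posC x y : disjoint_pos x y -> disjoint_pos y x.
Proof. by case=> x0 y0 xy; split; rewrite // riesz_infC. Qed.

Lemma disjoint_pos_le x y z : disjoint_pos x y -> 0 <= z -> z <= y ->
  disjoint_pos x z.
Proof.
case=> x0 y0 xy z0 zy; split=> //; apply: le_anti.
rewrite riesz_inf_ge0// andbT -xy riesz_infP riesz_infl.
by rewrite (le_trans (riesz_infr _ _)).
Qed.

Lemma disjoint_posD x y z : disjoint_pos x y -> disjoint_pos x z ->
  disjoint_pos x (y + z).
Proof.
case=> x0 y0 xy [_ z0 xz]; split; rewrite ?riesz_addr_ge0//; apply: le_anti.
rewrite riesz_inf_ge0 ?riesz_addr_ge0// andbT.
by rewrite (le_trans (riesz_inf_subadd x0 y0 z0))// xy xz addr0.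
Qed.

Lemma disjoint_pos0 x : 0 <= x -> disjoint_pos x 0.
Proof. by move=> x0; split=> //; rewrite riesz_infC riesz_inf_idl. Qed.

(** Additivity gives natural multiples. A real [a] is below some natural number, and disjointness
    passes to smaller positive elements. *)
Lemma disjoint_posZ (a : R) x y : 0 <= a -> disjoint_pos x y ->
  disjoint_pos x (a *: y).
Proof.
move=> a0 xy; have [x0 y0 _] := xy.
have xyn n : disjoint_pos x (n%:R *: y).
  elim: n => [|n IH]; first by rewrite scale0r; exact: disjoint_pos0.
  by rewrite -addn1 natrD scalerDl scale1r; exact: disjoint_posD.
apply: (disjoint_pos_le (xyn (Num.bound a))); first exact: riesz_scale_ge0.
by apply: riesz_lerZr => //; apply: ltW; exact: archi_boundP.
Qed.

Lemma disjoint_pos_self x : disjoint_pos x x -> x = 0.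
Proof. by case=> _ _; rewrite riesz_inf_idl. Qed.

Lemma disjoint_pos_below x y : disjoint_pos x y -> x <= y -> x = 0.
Proof. by case=> _ _ <- xy; rewrite riesz_inf_idl. Qed.

Lemma riesz_pos_neg x :
  [/\ disjoint_pos (riesz_sup x 0) (riesz_sup (- x) 0)
    & x = riesz_sup x 0 - riesz_sup (- x) 0].
Proof.
have xE : riesz_sup x 0 = x + riesz_sup (- x) 0.
  apply: le_anti; apply/andP; split.
    rewrite riesz_supP riesz_lewDr ?riesz_le_supr//=.
    by rewrite addrC -riesz_leBlDr sub0r riesz_le_supl.
  rewrite addrC -riesz_leBrDr riesz_supP !riesz_leBrDr addNr add0r.
  by rewrite riesz_le_supr riesz_le_supl.
split; last by rewrite xE addrK.
split; rewrite ?riesz_le_supr//; apply: le_anti.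
rewrite riesz_inf_ge0 ?riesz_le_supr// andbT.
set n := riesz_sup (- x) 0; set w := riesz_inf _ _.
(* Since [n - w] dominates both [- x] and [0], it dominates their supremum [n], so [w <= 0]. *)
have : - (w - n) >= n.
  rewrite riesz_supP riesz_leN2 riesz_leBlDr -xE riesz_infl/=.
  by rewrite opprB riesz_subr_ge0 riesz_infr.
by rewrite opprB -{1}[n]addr0 rieszD2l riesz_oppr_ge0.
Qed.

Lemma riesz_le_abs x : x <= riesz_abs x.
Proof. exact: riesz_le_supl. Qed.

Lemma riesz_leN_abs x : - x <= riesz_abs x.
Proof. exact: riesz_le_supr. Qed.

Lemma riesz_abs_ge0 x : 0 <= riesz_abs x.
Proof.
have := riesz_leD (riesz_le_abs x) (riesz_leN_abs x).
rewrite subrr -mulr2n -scaler_nat => h.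
have -> : riesz_abs x = 2^-1 *: (2%:R *: riesz_abs x).
  by rewrite scalerA mulVf ?scale1r// pnatr_eq0.
by rewrite riesz_scale_ge0// invr_ge0.
Qed.

(** * Archimedean spaces and their atoms *)

Hypothesis archE : archimedean_riesz E.

Lemma archimedean_le0 e u : 0 <= e -> (forall k : R, 0 < k -> u <= k *: e) ->
  u <= 0.
Proof.
move=> e0 ue; suff <- : riesz_sup u 0 = 0 by exact: riesz_le_supl.
(* The multiples of the positive part of [u] are all at most [e]. The index 0 is treated apart, so
   that [k] can be the inverse of [n.+1]. *)
apply: (archE (v := e)) (riesz_le_supr _ _) _ => -[|n]; first by rewrite mulr0n.
have n0 : 0 < n.+1%:R :> R by rewrite ltr0n.
have : riesz_sup u 0 <= n.+1%:R^-1 *: e.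
  by rewrite riesz_supP ue ?invr_gt0//= riesz_scale_ge0// invr_ge0 ltW.
move=> /(riesz_lerZl (ltW n0)); rewrite scalerA mulfV ?(gt_eqF n0)// scale1r.
by rewrite scaler_nat.
Qed.

(** The admissible coefficients are bounded, since otherwise every [e *+ n] would lie below [x].
    Their supremum is attained because [sup S *: e - x] is at most [k *: e] for every [k > 0]. *)
Lemma archimedean_sup e x : 0 <= e -> e != 0 -> 0 <= x ->
  exists s : R, [/\ 0 <= s, s *: e <= x & forall a, a *: e <= x -> a <= s].
Proof.
move=> e0 en0 x0; pose S : set R := fun a => a *: e <= x.
have S0 : S 0 by rewrite /S/= scale0r.
have supS : has_sup S.
  split; first by exists 0.
  apply: contrapT => unbS; move: en0; rewrite (archE (v := x) e0) ?eqxx// => n.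
  apply: contrapT => /negP ne; apply: unbS; exists n%:R => a Sa.
  rewrite leNgt; apply/negP => na; move/negP: ne; apply.
  by rewrite -scaler_nat (le_trans _ Sa)// riesz_lerZr// ltW.
have ubS a : S a -> a <= sup S by move=> Sa; apply: (ub_le_sup supS.2).
exists (sup S); split; [exact: ubS| |exact: ubS].
rewrite -riesz_subr_ge0 -opprB riesz_oppr_ge0.
apply: (archimedean_le0 e0) => k k0.
have [a Sa ka] := sup_adherent k0 supS.
rewrite riesz_leBlDr addrC -riesz_leBlDr -scalerBl.
by rewrite (le_trans _ Sa)// riesz_lerZr// ltW.
Qed.

Definition atom e :=
  [/\ 0 <= e, e != 0 & forall x, 0 <= x -> x <= e -> exists a : R, x = a *: e].

Lemma atom_scale_ge0 e (a : R) : atom e -> 0 <= a *: e -> 0 <= a.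
Proof.
case=> e0 en0 _ ae; rewrite leNgt; apply/negP => a0; move/negP: en0; apply.
have := riesz_scale_ge0 (- a^-1) _ _ ae.
rewrite scaleNr scalerA mulVf ?(lt_eqF a0)// scale1r oppr_ge0 invr_le0 (ltW a0).
move=> /(_ isT); rewrite riesz_oppr_ge0 => e0'.
by apply/eqP/le_anti; rewrite e0 e0'.
Qed.

(** Take the largest [s] with [s *: e <= x]. The infimum of [e] and the remainder is some [a *: e],
    and maximality of [s] forces [a <= 0]. *)
Lemma atom_decomposition e x : atom e -> 0 <= x ->
  exists s : R, [/\ 0 <= s, s *: e <= x & disjoint_pos e (x - s *: e)].
Proof.
move=> ate x0; have [e0 en0 eP] := ate.
have [s [s0 sx smax]] := archimedean_sup e0 en0 x0; exists s; split=> //.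
have x'0 : 0 <= x - s *: e by rewrite riesz_subr_ge0.
split=> //; apply: le_anti; rewrite riesz_inf_ge0// andbT.
have [a aE] := eP _ (riesz_inf_ge0 e0 x'0) (riesz_infl _ _).
have : a *: e <= x - s *: e by rewrite -aE riesz_infr.
rewrite riesz_leBrDr -scalerDl => /smax; rewrite gerDr => a0.
by rewrite aE -(scale0r e) riesz_lerZr.
Qed.

(** The infimum is a multiple of both atoms: either it vanishes, or its coefficient along [e] can be
    inverted. *)
Lemma atoms_disjoint_or_proportional e f : atom e -> atom f ->
  disjoint_pos e f \/ exists2 a : R, 0 <= a & e = a *: f.
Proof.
move=> ate atf; have [e0 en0 eP] := ate; have [f0 fn0 fP] := atf.
have w0 := riesz_inf_ge0 e0 f0.
have [a aE] := eP _ w0 (riesz_infl _ _).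
have [b bE] := fP _ w0 (riesz_infr _ _).
have [a0|an0] := eqVneq a 0; [left|right].
  by split; rewrite // aE a0 scale0r.
exists (a^-1 * b); last by rewrite -scalerA -bE aE scalerA mulVf// scale1r.
rewrite mulr_ge0// ?invr_ge0; first by apply: (atom_scale_ge0 ate); rewrite -aE.
by apply: (atom_scale_ge0 atf); rewrite -bE.
Qed.

(* If [x] is between [0] and [e] then each [x - a e] has trivial positive or
   negative part, so [x] is [e] times the largest [a] with [a e <= x]. *)
Lemma atom_or_split e : 0 <= e -> e != 0 -> atom e \/
  exists x y, [/\ disjoint_pos x y, x != 0, y != 0 &
    exists2 c : R, 0 <= c & x <= c *: e /\ y <= c *: e].
Proof.
move=> e0 en0; apply: contrapT => /not_orP[nat nsplit]; apply: nat.
split=> // x x0 xe.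
have compar (a : R) : 0 <= x - a *: e \/ x - a *: e <= 0.
  have [disj xaE] := riesz_pos_neg (x - a *: e).
  have [p0|pn0] := eqVneq (riesz_sup (x - a *: e) 0) 0.
    right; rewrite xaE p0 sub0r -riesz_oppr_ge0 opprK; exact: riesz_le_supr.
  have [n0|nn0] := eqVneq (riesz_sup (- (x - a *: e)) 0) 0.
    by left; rewrite xaE n0 subr0 riesz_le_supr.
  exfalso; apply: nsplit.
  (* As [0 <= x <= e], both [x - a *: e] and its opposite are at most [(1 + |a|) *: e]. *)
  have c0 : 0 <= 1 + `|a| by rewrite addr_ge0.
  exists (riesz_sup (x - a *: e) 0), (riesz_sup (- (x - a *: e)) 0).
  split=> //; exists (1 + `|a|) => //.
  split; rewrite riesz_supP riesz_scale_ge0// andbT.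
    have ae : - (a *: e) <= `|a| *: e.
      by rewrite -scaleNr riesz_lerZr// -normrN ler_norm.
    by apply: le_trans (riesz_leD xe ae) _; rewrite scalerDl scale1r.
  have ae : a *: e <= (1 + `|a|) *: e.
    by rewrite riesz_lerZr// (le_trans (ler_norm a))// lerDr.
  have nx0 : - x <= 0 by rewrite -riesz_oppr_ge0 opprK.
  by have := riesz_leD ae nx0; rewrite addr0 opprB.
have [s [s0 sx smax]] := archimedean_sup e0 en0 x0; exists s.
apply: le_anti; rewrite sx andbT -riesz_subr_ge0 -opprB riesz_oppr_ge0.
apply: (archimedean_le0 e0) => k k0.
rewrite riesz_leBlDr -scalerDl -riesz_subr_ge0 -opprB riesz_oppr_ge0.
have [|//] := compar (k + s).
by rewrite riesz_subr_ge0 => /smax; rewrite gerDr leNgt k0.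
Qed.

End RieszTheory.

(** * Spans of disjoint elements and of atoms *)

Section AtomSpan.
Variables (R : realType) (E : finRieszType R).
Implicit Types (e p u x y z : E) (X L : seq E).

(** The witness is the combination of [X] with the absolute values of the coordinates of [y]. It
    transfers disjointness from the generators to anything positive below [riesz_abs y]. *)
Lemma span_dominated X y :
    {in X, forall x, 0 <= x} -> y \in <<X>>%VS ->
  exists u, [/\ 0 <= u, riesz_abs y <= u & forall z, 0 <= z ->
    {in X, forall x, disjoint_pos z x} -> disjoint_pos z u].
Proof.
move=> X0 yX; pose c i := coord (in_tuple X) i y.
have yE : y = \sum_i c i *: (in_tuple X)`_i by exact: coord_span.
have Xi0 (i : 'I_(size X)) : 0 <= (in_tuple X)`_i by apply/X0/mem_nth/ltn_ord.
exists (\sum_i `|c i| *: (in_tuple X)`_i); split.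
- by apply: riesz_sum_ge0 => i _; exact: riesz_scale_ge0.
- rewrite /riesz_abs riesz_supP yE -sumrN; apply/andP.
  by split; apply: riesz_ler_sum => i _; rewrite -?scaleNr riesz_lerZr//
    ?ler_norm// -normrN ler_norm.
- move=> z z0 zX; apply: (big_ind (disjoint_pos z)).
  + exact: disjoint_pos0.
  + by move=> ? ?; exact: disjoint_posD.
  + by move=> i _; apply: disjoint_posZ => //; apply/zX/mem_nth/ltn_ord.
Qed.

Lemma disjoint_span z X y : 0 <= z -> {in X, forall x, disjoint_pos z x} ->
  y \in <<X>>%VS -> 0 <= y -> disjoint_pos z y.
Proof.
move=> z0 zX yX y0.
have [|u [_ yu zu]] := span_dominated _ yX; first by move=> x /zX[].
apply: disjoint_pos_le (zu z z0 zX) y0 _.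
by apply: le_trans yu; exact: riesz_le_abs.
Qed.

Definition disjoint_seq X :=
  [/\ uniq X, {in X, forall x, x != 0}, {in X, forall x, 0 <= x}
    & {in X &, forall x y, x != y -> disjoint_pos x y}].

(** An element in the span of the others would be disjoint from itself, hence zero. *)
Lemma disjoint_seq_free X : disjoint_seq X -> free X.
Proof.
elim: X => [|x X IH]; first by rewrite nil_free.
case=> /= /andP[xX uX] n0 p0 dX; rewrite free_cons; apply/andP; split.
  apply/negP => xsX; have := n0 x (mem_head _ _).
  rewrite (@disjoint_pos_self _ _ x) ?eqxx//.
  have x0 := p0 x (mem_head _ _).
  apply: (disjoint_span (X := X)) => // y yX.
  apply: dX; rewrite ?mem_head// ?inE ?yX ?orbT//.
  by apply: contraNneq xX => ->.
apply: IH; split=> // [y yX|y yX|y z yX zX];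
  by [apply: n0; rewrite inE yX orbT|apply: p0; rewrite inE yX orbT|
      apply: dX; rewrite inE ?yX ?zX orbT].
Qed.

(** Without atoms, splitting never stops: keep one half [p], split the other half [q] again, and
    obtain more disjoint nonzero elements than the dimension allows. Each element stays below a
    multiple of the starting point; for those obtained from [q], this makes them disjoint from
    [p]. *)
Lemma exists_atom (archE : archimedean_riesz E) e :
  0 <= e -> e != 0 -> exists p, atom p.
Proof.
move=> e0 en0; apply: contrapT => noatom.
have [X [dX sX _]] : exists X, [/\ disjoint_seq X, size X = (\dim {:E}).+1 &
    {in X, forall x, exists2 c : R, 0 <= c & x <= c *: e}].
  elim: (\dim _).+1 e e0 en0 => [|k IH] e e0 en0; first by exists [::].
  have [ate|] := atom_or_split archE e0 en0; first by case: noatom; exists e.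
  move=> [p [q [pq pn0 qn0 [c c0 [pc qc]]]]].
  have [p0 q0 _] := pq.
  have [X [[uX n0 X0 dX] sX Xq]] := IH q q0 qn0.
  have pX x : x \in X -> disjoint_pos p x.
    move=> xX; have [b b0 xb] := Xq x xX.
    exact: disjoint_pos_le (disjoint_posZ b0 pq) (X0 x xX) xb.
  exists (p :: X); split; last 1 first.
  - move=> x; rewrite inE => /predU1P[->|xX]; first by exists c.
    have [b b0 xb] := Xq x xX; exists (b * c); first exact: mulr_ge0.
    by rewrite -scalerA (le_trans xb)// riesz_lerZl.
  - split.
    + rewrite /= uX andbT; apply/negP => /pX/disjoint_pos_self p00.
      by rewrite p00 eqxx in pn0.
    + by move=> x; rewrite inE => /predU1P[->|/n0].
    + by move=> x; rewrite inE => /predU1P[->|/X0].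
    + move=> x y; rewrite !inE => /predU1P[->|xX] /predU1P[->|yX].
      * by rewrite eqxx.
      * by move=> _; exact: pX.
      * by move=> _; apply: disjoint_posC; exact: pX.
      * exact: dX.
  - by rewrite /= sX.
have := dimvS (subvf <<X>>%VS); rewrite leqNgt => /negP; apply.
by have /eqP -> := disjoint_seq_free dX; rewrite sX.
Qed.

Hypothesis archE : archimedean_riesz E.

(** Atoms are split off one after the other. Each remainder is smaller than the previous one, so it
    stays disjoint from the atoms already treated. *)
Lemma atoms_decomposition L x : uniq L -> {in L, forall y, atom y} -> 0 <= x ->
  exists a : E -> R, [/\ forall y, 0 <= a y, \sum_(y <- L) a y *: y <= x
    & {in L, forall y, disjoint_pos y (x - \sum_(y <- L) a y *: y)}].
Proof.
move=> + + x0; elim: L => [_ _|e L IH /= /andP[eL uL] atL].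
  by exists (fun=> 0); split; rewrite ?big_nil.
have [|a [a0 ax dx]] := IH uL.
  by move=> y yL; apply: atL; rewrite inE yL orbT.
set x' := x - _ in dx; have x'0 : 0 <= x' by rewrite riesz_subr_ge0.
have [s [s0 sx ds]] := atom_decomposition archE (atL e (mem_head _ _)) x'0.
pose b y := if y == e then s else a y.
have bE : \sum_(y <- e :: L) b y *: y = \sum_(y <- L) a y *: y + s *: e.
  rewrite big_cons /b eqxx addrC; congr (_ + _).
  by apply: eq_big_seq => y yL; case: eqP => // ye; rewrite -ye yL in eL.
exists b; rewrite bE; split.
- by move=> y; rewrite /b; case: ifP.
- by rewrite addrC -riesz_leBrDr.
- move=> y; rewrite opprD addrA -/x' inE => /predU1P[->//|yL].
  have [e0 _ _] := atL e (mem_head _ _).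
  apply: disjoint_pos_le (dx y yL) _ _; first by case: ds.
  by rewrite riesz_leBlDr riesz_lewDr// riesz_scale_ge0.
Qed.

(** The remainder of [x] after removing its components along [L] is disjoint from the dominating
    element [u], yet lies below it, so it vanishes. *)
Lemma atoms_span_solid L x y : uniq L -> {in L, forall y, atom y} ->
    y \in <<L>>%VS -> 0 <= x -> x <= riesz_abs y ->
  exists2 a : E -> R, forall y, 0 <= a y & x = \sum_(y <- L) a y *: y.
Proof.
move=> uL atL yL x0 xy.
have L0 : {in L, forall y, 0 <= y} by move=> z /atL[].
have [u [u0 yu du]] := span_dominated L0 yL.
have [a [a0 ax dx]] := atoms_decomposition uL atL x0; exists a => //.
set p := \sum_(y <- L) _ in ax dx *.
have p0 : 0 <= p.
  by rewrite /p big_seq; apply: riesz_sum_ge0 => z /L0; exact: riesz_scale_ge0.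
have x'0 : 0 <= x - p by rewrite riesz_subr_ge0.
apply/eqP; rewrite -subr_eq0; apply/eqP.
apply: (@disjoint_pos_below _ _ _ u).
  by apply: du => // z zL; apply: disjoint_posC; exact: dx.
apply: le_trans (le_trans xy yu).
by rewrite riesz_leBlDr riesz_lewDr.
Qed.

Lemma sum_in_span (a : E -> R) L : \sum_(y <- L) a y *: y \in <<L>>%VS.
Proof.
by rewrite big_seq; apply: rpred_sum => y yL; rewrite rpredZ// memv_span.
Qed.

Lemma atoms_span_ideal L : uniq L -> {in L, forall y, atom y} ->
  is_ideal <<L>>%VS.
Proof.
move=> uL atL x y yL xy; have [_ ->] := riesz_pos_neg x.
have pos z : 0 <= z -> z <= riesz_abs x -> z \in <<L>>%VS.
  move=> z0 zx; have [a _ ->] := atoms_span_solid uL atL yL z0 (le_trans zx xy).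
  exact: sum_in_span.
by rewrite rpredB// pos ?riesz_le_supr// riesz_supP
  ?riesz_le_abs ?riesz_leN_abs riesz_abs_ge0.
Qed.

(** Fix [y0] in [D] and write [x - y0] as [p] in the span plus a remainder disjoint from [L]. For
    [d] in [D] the positive part of [d - y0] lies in the span, so it misses the remainder and is at
    most [p]. Thus [p + y0] bounds [D], and leastness of [x] gives [x = p + y0]. *)
Lemma atoms_span_band L : uniq L -> {in L, forall y, atom y} ->
  is_band <<L>>%VS.
Proof.
move=> uL atL; have idL := atoms_span_ideal uL atL; split=> // D x DL [ubx lbx].
have [[y0 Dy0]|D0] := pselect (exists y, D y); last first.
  (* Every element bounds the empty set, so [x] is the least element of the space. *)
  have xle z : x <= z by apply: lbx => y Dy; case: D0; exists y.
  suff -> : x = 0 by exact: mem0v.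
  apply: le_anti; rewrite xle/=.
  by have := xle (x + x); rewrite -{1}[x]addr0 rieszD2l.
have z0 : 0 <= x - y0 by rewrite riesz_subr_ge0; exact: ubx.
have [a [a0 ax dx]] := atoms_decomposition uL atL z0.
set p := \sum_(y <- L) _ in ax dx.
have L0 : {in L, forall y, 0 <= y} by move=> z /atL[].
have p0 : 0 <= p.
  by rewrite /p big_seq; apply: riesz_sum_ge0 => z /L0; exact: riesz_scale_ge0.
suff xp : x - y0 <= p.
  have /eqP : x - y0 = p by apply: le_anti; rewrite xp ax.
  by rewrite subr_eq => /eqP ->; rewrite rpredD ?sum_in_span// DL.
rewrite riesz_leBlDr; apply: lbx => d Dd; rewrite -riesz_leBlDr.
apply: (le_trans (riesz_le_supl _ 0)); set q := riesz_sup _ _.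
have q0 : 0 <= q by exact: riesz_le_supr.
have qL : q \in <<L>>%VS.
  apply: (idL _ (d - y0)); first by rewrite rpredB// DL.
  rewrite {1}/riesz_abs riesz_supP /q riesz_supP riesz_le_abs riesz_abs_ge0/=.
  by rewrite (le_trans _ (riesz_abs_ge0 _))// -riesz_oppr_ge0 opprK.
have qx : q <= p + (x - y0 - p).
  by rewrite addrC subrK riesz_supP z0 rieszD2r ubx.
have x'0 : 0 <= x - y0 - p by rewrite riesz_subr_ge0.
have [_ _ dq] : disjoint_pos q (x - y0 - p).
  apply: disjoint_posC; apply: (disjoint_span (X := L)) => // y yL.
  by apply: disjoint_posC; exact: dx.
have := riesz_inf_subadd q0 p0 x'0; rewrite (riesz_inf_idl qx) dq addr0.
by move=> /le_trans; apply; exact: riesz_infr.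
Qed.

End AtomSpan.

(** * Trace of an endomorphism *)

Section Trace.
Variable R : realType.
Implicit Types U V : vectType R.

Lemma lftraceC U V (S : 'Hom(U, V)) (T : 'Hom(V, U)) :
  lftrace (T \o S)%VF = lftrace (S \o T)%VF.
Proof.
by rewrite /lftrace (passmx.mxof_comp _ _ (vbasisP _)) mxtrace_mulC
  -(passmx.mxof_comp _ _ (vbasisP _)).
Qed.

Lemma lftrace_basis V (b : (\dim {:V}).-tuple V) (f : 'End(V)) :
  basis_of {:V} b -> lftrace f = \sum_i coord b i (f b`_i).
Proof.
(* Factoring [f] as [f] after the identity, through the basis [b], and commuting the two matrices
   under the trace changes the basis. *)
move=> bV; rewrite /lftrace -[f in LHS]comp_lfun1r (passmx.mxof_comp _ _ bV).
rewrite mxtrace_mulC -(passmx.mxof_comp _ _ (vbasisP _)) comp_lfun1l.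
by apply: eq_bigr => i _; rewrite !mxE/= passmx.vecof_delta.
Qed.

Lemma lftrace1 V : lftrace (\1%VF : 'End(V)) = (\dim {:V})%:R.
Proof.
by rewrite /lftrace passmx.mxof1 ?mxtrace1// (basis_free (vbasisP _)).
Qed.

End Trace.

(** * Lattice isomorphisms and positivity *)

Section LatticeIso.
Variable R : realType.
Implicit Types E F : finRieszType R.

Lemma lattice_iso_le E F (T : 'Hom(E, F)) : lattice_iso T ->
  {homo T : x y / x <= y}.
Proof.
case=> _ _ Tinf x y xy; rewrite -(riesz_inf_idl xy) Tinf; exact: riesz_infr.
Qed.

(** Positivity in both directions makes [T] an order isomorphism, and suprema and infima are
    determined by the order. *)
Lemma pos_inverse_lattice_iso E F (T : 'Hom(E, F)) (S : 'Hom(F, E)) :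
  cancel T S -> cancel S T -> (forall x, 0 <= x -> 0 <= T x) ->
  (forall y, 0 <= y -> 0 <= S y) -> lattice_iso T.
Proof.
move=> TK SK Tpos Spos.
have Tle x y : (T x <= T y) = (x <= y).
  apply/idP/idP => xy.
    by rewrite -riesz_subr_ge0 -[y - x]TK Spos// linearB riesz_subr_ge0.
  by rewrite -riesz_subr_ge0 -linearB Tpos// riesz_subr_ge0.
have leT x z : (T x <= z) = (x <= S z) by rewrite -{1}[z]SK Tle.
have geT x z : (z <= T x) = (S z <= x) by rewrite -{1}[z]SK Tle.
split; first by exists S.
- move=> x y; apply: le_anti; rewrite leT riesz_supP -!leT.
  by rewrite riesz_le_supl riesz_le_supr riesz_supP !Tle
    riesz_le_supl riesz_le_supr.
- move=> x y; apply: le_anti; rewrite geT !riesz_infP -!geT !Tle.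
  by rewrite riesz_infl riesz_infr riesz_infl riesz_infr.
Qed.

End LatticeIso.

(** * Orbits of atoms, stabilizers and characters *)

Section Representation.
Variables (R : realType) (gT : finGroupType) (G : {group gT}).
Variables (E : finRieszType R) (rho : pos_repr G E).
Implicit Types (e x y : E) (s t : gT).

Lemma pos_reprMx s t x : s \in G -> t \in G ->
  rho (s * t)%g x = rho s (rho t x).
Proof. by move=> sG tG; rewrite pos_reprM// lfunE. Qed.

Lemma pos_repr1 x : rho 1%g x = x.
Proof.
have [/bij_inj inj1 _ _] := pos_repr_aut rho (group1 G).
by apply: inj1; rewrite -pos_reprMx ?group1// mulg1.
Qed.

Lemma pos_reprK s : s \in G -> cancel (rho s) (rho s^-1%g).
Proof. by move=> sG x; rewrite -pos_reprMx ?groupV// mulVg pos_repr1. Qed.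

Lemma pos_repr_ge0 s x : s \in G -> 0 <= x -> 0 <= rho s x.
Proof.
by move=> sG x0; rewrite -(linear0 (rho s)); apply: lattice_iso_le => //;
  exact: pos_repr_aut.
Qed.

Lemma pos_repr_atom e s : s \in G -> atom e -> atom (rho s e).
Proof.
move=> sG [e0 en0 eP]; split; first exact: pos_repr_ge0.
  by apply: contraNneq en0 => se0; rewrite -(pos_reprK sG e) se0 linear0.
have VsG : s^-1%g \in G by rewrite groupV.
move=> x x0 xe; have [|a aE] := eP (rho s^-1%g x) (pos_repr_ge0 VsG x0).
  by rewrite -[leRHS](pos_reprK sG); apply: lattice_iso_le => //;
    exact: pos_repr_aut.
exists a; rewrite -linearZ/= -aE -pos_reprMx// mulgV; exact/esym/pos_repr1.
Qed.

(** If [n] is the order of [s] then [c ^+ n = 1], and the only nonnegative real root of unity is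
    1. *)
Lemma pos_repr_eigen1 e s (c : R) : s \in G -> e != 0 -> 0 <= c ->
  rho s e = c *: e -> rho s e = e.
Proof.
move=> sG en0 c0 se.
have sn n : rho (s ^+ n)%g e = c ^+ n *: e.
  elim: n => [|n IH]; first by rewrite pos_repr1 expr0 scale1r.
  by rewrite expgSr pos_reprMx ?groupX// se linearZ/= IH scalerA exprS.
suff c1 : c = 1 by rewrite se c1 scale1r.
apply/eqP; rewrite -(pexpr_eq1 (order_gt0 s) c0) -subr_eq0.
have /eqP : (c ^+ #[s]%g - 1) *: e = 0.
  by rewrite scalerBl -sn expg_order pos_repr1 scale1r subrr.
by rewrite scaler_eq0 (negPf en0) orbF.
Qed.

Definition orbit_seq e : seq E := undup [seq rho s e | s <- enum G].

Lemma orbit_seqP e x :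
  reflect (exists2 s, s \in G & x = rho s e) (x \in orbit_seq e).
Proof.
rewrite mem_undup; apply: (iffP mapP) => -[s sG ->]; exists s => //.
  by rewrite mem_enum in sG.
by rewrite mem_enum.
Qed.

Lemma orbit_atom e : atom e -> {in orbit_seq e, forall x, atom x}.
Proof. by move=> ate x /orbit_seqP[s sG ->]; exact: pos_repr_atom. Qed.

Lemma orbit_disjoint e : atom e -> disjoint_seq (orbit_seq e).
Proof.
move=> ate; have atL := orbit_atom ate; split.
- exact: undup_uniq.
- by move=> x /atL[].
- by move=> x /atL[].
move=> x y xL yL; have atx := atL x xL; have aty := atL y yL.
have [//|[a a0 xy]] := atoms_disjoint_or_proportional atx aty.
move=> /eqP[]; move: xL yL atx aty xy.
move=> /orbit_seqP[s sG ->] /orbit_seqP[t tG ->] _ [_ tn0 _] st.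
(* Proportional orbit points make [rho t e] an eigenvector of [s * t^-1] with eigenvalue [a >= 0],
   so they coincide. *)
have stG : (s * t^-1)%g \in G by rewrite groupM ?groupV.
have stE : rho (s * t^-1)%g (rho t e) = rho s e.
  by rewrite -pos_reprMx// mulgKV.
by rewrite -stE; apply: (pos_repr_eigen1 stG tn0 a0); rewrite stE.
Qed.

Definition generating e := atom e /\ <<orbit_seq e>>%VS = {:E}%VS.

Lemma generating_basis e : generating e -> basis_of {:E} (orbit_seq e).
Proof.
by case=> ate Lf; rewrite /basis_of Lf eqxx disjoint_seq_free//;
  exact: orbit_disjoint.
Qed.

(** The span of the orbit of an atom is an invariant band containing that atom, so irreducibility
    leaves only the whole space. An atom exists because a nonzero vector has a nonzero positive or
    negative part. *)
Lemma irreducible_generating : archimedean_riesz E -> irreducible rho ->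
  {:E}%VS != 0%VS -> exists e, generating e.
Proof.
move=> archE irr En0.
have [x xn0] : exists x : E, x != 0.
  by exists (vpick {:E}); rewrite vpick0.
have [e ate] : exists e : E, atom e.
  have [_ xE] := riesz_pos_neg x.
  have [p0|pn0] := eqVneq (riesz_sup x 0) 0; last first.
    by apply: (exists_atom archE _ pn0); exact: riesz_le_supr.
  have [q0|qn0] := eqVneq (riesz_sup (- x) 0) 0; last first.
    by apply: (exists_atom archE _ qn0); exact: riesz_le_supr.
  by move: xn0; rewrite xE p0 q0 subrr eqxx.
exists e; split=> //; have [uL _ _ _] := orbit_disjoint ate.
have [||e0|//] := irr <<orbit_seq e>>%VS.
- exact: (atoms_span_band archE uL (orbit_atom ate)).
- move=> s sG; rewrite limg_span.
  apply/span_subvP => _ /mapP[_ /orbit_seqP[t tG ->] ->].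
  rewrite -pos_reprMx//; apply/memv_span/orbit_seqP.
  by exists (s * t)%g; rewrite ?groupM.
- have [_ /eqP[]] := ate; apply/eqP; rewrite -memv0 -e0.
  apply/memv_span/orbit_seqP.
  by exists 1%g; rewrite ?group1// pos_repr1.
Qed.

Definition stab e : {set gT} := [set s in G | rho s e == e].

Lemma stab_group_set e : group_set (stab e).
Proof.
apply/group_setP; split=> [|s t]; first by rewrite inE group1 pos_repr1 eqxx.
rewrite !inE => /andP[sG /eqP se] /andP[tG /eqP te].
by rewrite groupM//= pos_reprMx// te se.
Qed.

(** The stabilizer of [rho t e] is a conjugate of [stab e], hence equal to it by normality. *)
Lemma orbit_fixed e s t : (forall H : {group gT}, H \subset G -> (H <| G)%g) ->
  s \in G -> t \in G -> (rho s (rho t e) == rho t e) = (rho s e == e).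
Proof.
move=> normG sG tG.
have sH : Group (stab_group_set e) \subset G.
  by apply/fintype.subsetP => u; rewrite inE => /andP[].
have nH : t \in ('N(stab e))%g.
  exact: fintype.subsetP (normal_norm (normG _ sH)) t tG.
have := memJ_norm s nH; rewrite !inE groupJ// sG /= => <-.
rewrite conjgE !pos_reprMx ?groupM ?groupV//.
rewrite -[in RHS](inj_eq (can_inj (pos_reprK tG))).
by rewrite -!pos_reprMx ?groupM ?groupV// !mulgA mulgV mul1g.
Qed.

Lemma pos_character1 : pos_character rho 1%g = (\dim {:E})%:R.
Proof.
rewrite -lftrace1 /pos_character; congr lftrace.
by apply/lfunP => x; rewrite pos_repr1 lfunE.
Qed.

(** In the orbit basis [rho s] is a permutation matrix. By [orbit_fixed] it fixes all basis vectors
    or none, so its diagonal is all ones or all zeros. *)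
Lemma generating_character e s :
  (forall H : {group gT}, H \subset G -> (H <| G)%g) ->
  generating e -> s \in G ->
  pos_character rho s = if rho s e == e then (\dim {:E})%:R else 0.
Proof.
move=> normG gen sG; have bL := generating_basis gen.
have sL : size (orbit_seq e) == \dim {:E}.
  by case: gen => _ <-; rewrite eq_sym; exact: basis_free bL.
pose b := Tuple sL; have fb : free b := basis_free bL.
have bP (i : 'I_(\dim {:E})) : exists2 t, t \in G & b`_i = rho t e.
  by apply/orbit_seqP/mem_nth; rewrite (eqP sL).
rewrite /pos_character (lftrace_basis (b := b))//; case: ifPn => se.
  rewrite -[X in X%:R]card_ord -sumr_const; apply: eq_bigr => i _.
  suff -> : rho s b`_i = b`_i by rewrite coord_free// eqxx.
  by have [t tG ->] := bP i; apply/eqP; rewrite orbit_fixed.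
apply: big1 => i _; have [t tG bi] := bP i.
have /(nthP 0)[j jL bj] : rho s b`_i \in orbit_seq e.
  by apply/orbit_seqP; exists (s * t)%g; rewrite ?groupM// bi pos_reprMx.
rewrite (eqP sL) in jL; rewrite -bj.
have := coord_free (Ordinal jL) i fb; rewrite /= => ->; case: eqP => // ji.
by move: se; rewrite -(orbit_fixed e normG sG tG) -bi -bj -ji eqxx.
Qed.

End Representation.

(** * Linear maps prescribed on a generating orbit *)

Section Transfer.
Variables (R : realType) (gT : finGroupType) (G : {group gT}).
Variables (E F : finRieszType R) (rho : pos_repr G E) (theta : pos_repr G F).
Variable e : E.
Hypothesis gen : generating rho e.

Lemma generating_lfun_eq (V : vectType R) (S T : 'Hom(E, V)) :
  {in G, forall s, S (rho s e) = T (rho s e)} -> S = T.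
Proof.
move=> ST; have [_ Lf] := gen; apply/lfunP => x.
suff : ({:E} <= lker (S - T))%VS.
  move=> /subvP/(_ x (memvf x)).
  by rewrite memv_ker !lfunE/= lfunE/= subr_eq0 => /eqP.
rewrite -Lf; apply/span_subvP => _ /orbit_seqP[s sG ->].
by rewrite memv_ker !lfunE/= lfunE/= ST// subrr.
Qed.

Lemma orbit_lfun (f : F) :
  {in G, forall s, rho s e = e -> theta s f = f} ->
  exists T : 'Hom(E, F), {in G, forall s, T (rho s e) = theta s f}.
Proof.
move=> stab_ef.
(* [g x] picks a group element carrying [e] to [x]; the default 1 is never reached on the orbit. *)
pose g x := odflt 1%g [pick s in G | rho s e == x].
have [T TP] := linear_of_free (orbit_seq rho e)
  [seq theta (g x) f | x <- orbit_seq rho e].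
exists (linfun T) => s sG; rewrite lfunE/=.
have /eq_in_map TE := TP (basis_free (generating_basis gen)) (size_map _ _).
rewrite TE; last by apply/orbit_seqP; exists s.
rewrite /g; case: pickP => [t /andP[tG /eqP ts]|/(_ s)] /=; last first.
  by rewrite sG eqxx.
(* Independence of the choice: [t^-1 * s] fixes [e], hence also [f]. *)
have VtsG : (t^-1 * s)%g \in G by rewrite groupM ?groupV.
rewrite -[in RHS](mulKVg t s) pos_reprMx// [theta (t^-1 * s)%g f]stab_ef//.
by rewrite pos_reprMx ?groupV// -ts pos_reprK.
Qed.

(** A positive vector has nonnegative coefficients along the orbit, by [atoms_span_solid] applied to
    the vector itself. *)
Lemma orbit_lfun_pos (archE : archimedean_riesz E) (T : 'Hom(E, F)) (f : F) :
  0 <= f -> {in G, forall s, T (rho s e) = theta s f} ->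
  forall x, 0 <= x -> 0 <= T x.
Proof.
move=> f0 Te x x0; have [ate Lf] := gen.
have [uL _ _ _] := orbit_disjoint rho ate.
have xL : x \in <<orbit_seq rho e>>%VS by rewrite Lf memvf.
have [a a0 ->] :=
  atoms_span_solid archE uL (orbit_atom ate) xL x0 (riesz_le_abs x).
rewrite linear_sum big_seq; apply: riesz_sum_ge0 => _ /orbit_seqP[s sG ->].
rewrite linearZ; apply: riesz_scale_ge0 => //=.
by rewrite Te//; exact: pos_repr_ge0.
Qed.

End Transfer.

(** * From linear equivalence to characters to order equivalence *)

Section Equivalence.
Variables (R : realType) (gT : finGroupType) (G : {group gT}).
Variables (E F : finRieszType R) (rho : pos_repr G E) (theta : pos_repr G F).

Lemma linearly_equivalent_character : linearly_equivalent rho theta ->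
  {in G, pos_character rho =1 pos_character theta}.
Proof.
move=> [T [[S TK SK] Tint]] s sG.
have TVK : (T^-1 \o T = \1)%VF.
  by apply: lker0_compVf; apply/lker0P/(can_inj TK).
have TKV : (T \o T^-1 = \1)%VF.
  apply/lfunP => y; rewrite !lfunE/= -[y]SK.
  by have /lfunP/(_ (S y)) := TVK; rewrite !lfunE/= => ->.
rewrite /pos_character -[rho s]comp_lfun1l -TVK -comp_lfunA lftraceC.
by rewrite Tint// -comp_lfunA TKV comp_lfun1r.
Qed.

Hypothesis normG : forall H : {group gT}, H \subset G -> (H <| G)%g.
Hypotheses (archE : archimedean_riesz E) (archF : archimedean_riesz F).
Hypotheses (irr_rho : irreducible rho) (irr_theta : irreducible theta).

Lemma character_order_equivalent :
    {in G, pos_character rho =1 pos_character theta} ->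
  order_equivalent rho theta.
Proof.
move=> chi; have dimEF : \dim {:E} = \dim {:F}.
  apply/eqP; rewrite -(eqr_nat R) -(pos_character1 rho).
  by rewrite -(pos_character1 theta) chi.
(* The zero space has no atom and is treated separately. *)
have [E0|En0] := eqVneq {:E}%VS 0%VS.
  have F0 : {:F}%VS = 0%VS by apply/eqP; rewrite -dimv_eq0 -dimEF E0 dimv0.
  have E00 (x : E) : x = 0 by apply/eqP; rewrite -memv0 -E0 memvf.
  have F00 (y : F) : y = 0 by apply/eqP; rewrite -memv0 -F0 memvf.
  exists 0; split.
    split; [|by move=> x y; rewrite [RHS]F00 [LHS]F00..].
    by exists (fun=> 0) => [x|y]; [rewrite [RHS]E00|rewrite [LHS]F00 [RHS]F00].
  by move=> s sG; apply/lfunP => x; rewrite [LHS]F00 [RHS]F00.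
have Fn0 : {:F}%VS != 0%VS by rewrite -dimv_eq0 -dimEF dimv_eq0.
have [e gene] := irreducible_generating archE irr_rho En0.
have [f genf] := irreducible_generating archF irr_theta Fn0.
(* The common dimension is nonzero, so the two values of the character are distinct and it detects
   the stabilizer. *)
have stabEF s : s \in G -> (rho s e == e) = (theta s f == f).
  move=> sG; have := chi s sG.
  rewrite (generating_character normG gene)//.
  rewrite (generating_character normG genf)//.
  have dF : (\dim {:F})%:R != 0 :> R by rewrite pnatr_eq0 dimv_eq0.
  rewrite dimEF; case: ifP; case: ifP => // _ _ /eqP; rewrite ?(negPf dF)//.
  by rewrite eq_sym (negPf dF).
have [T TE] : exists T : 'Hom(E, F), {in G, forall s, T (rho s e) = theta s f}.
  by apply: (orbit_lfun gene) => s sG /eqP; rewrite stabEF// => /eqP.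
(* Equality of the stabilizers makes the construction symmetric, which yields a positive inverse of
   [T]. *)
have [S SE] : exists S : 'Hom(F, E), {in G, forall s, S (theta s f) = rho s e}.
  by apply: (orbit_lfun genf) => s sG /eqP; rewrite -stabEF// => /eqP.
exists T; split.
  have [[[e0 _ _] _] [[f0 _ _] _]] := (gene, genf).
  apply: (pos_inverse_lattice_iso (S := S)).
  - suff /lfunP h : (S \o T)%VF = \1%VF.
      by move=> x; have := h x; rewrite !lfunE.
    by apply: (generating_lfun_eq gene) => s sG; rewrite !lfunE/= TE// SE.
  - suff /lfunP h : (T \o S)%VF = \1%VF.
      by move=> x; have := h x; rewrite !lfunE.
    by apply: (generating_lfun_eq genf) => s sG; rewrite !lfunE/= SE// TE.
  - exact: (orbit_lfun_pos gene archE f0 TE).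
  - exact: (orbit_lfun_pos genf archF e0 SE).
move=> s sG; apply: (generating_lfun_eq gene) => t tG; rewrite !lfunE/=.
by rewrite -(pos_reprMx rho)// !TE ?groupM// pos_reprMx.
Qed.

End Equivalence.

Theorem corollary4p14 (R : realType) (gT : finGroupType) (G : {group gT})
    (normG : forall H : {group gT}, H \subset G -> (H <| G)%g)
    (E F : finRieszType R)
    (archE : archimedean_riesz E) (archF : archimedean_riesz F)
    (rho : pos_repr G E) (theta : pos_repr G F)
    (irr_rho : irreducible rho) (irr_theta : irreducible theta) :
  (linearly_equivalent rho theta <->
     {in G, pos_character rho =1 pos_character theta}) /\
  (linearly_equivalent rho theta -> order_equivalent rho theta).
Proof.
split; last first.
  by move=> /linearly_equivalent_character; exact: character_order_equivalent.
split; first exact: linearly_equivalent_character.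
(* Equal characters give linear equivalence by way of order equivalence, without general character
   theory. *)
move=> /(character_order_equivalent normG archE archF irr_rho irr_theta).
by case=> T [[bijT _ _] Tint]; exists T.
Qed.
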